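(* Let $d\ge 1$, let $X\in\mathbb{R}^d$ and $S\in[0,1]$ be jointly distributed random variables, let $\sigma>0$, and let $X^\sigma = X+\sigma Z$ with $Z\sim\mathcal N(0,I)$ independent of $(X,S)$. Let $\mathcal D_{\mathrm{train}}=\{(X_i^\sigma,S_i)\}_{i=1}^n$ be $n$ i.i.d. samples of $(X^\sigma,S)$ and let $\mathcal H\subseteq\{f:\mathbb R^d\to[0,1]\}$ be a class of (Borel measurable) functions. Then $$\mathrm{MMSE}(S\vert X^\sigma)\ \ge\ \mathrm{MSE}_{\mathrm{train}}(\hat h_{\mathcal H})-\epsilon_C-\epsilon_A ,$$ where $$\epsilon_C := \mathrm{MSE}_{\mathrm{train}}(h^*_{\mathcal H})-\mathrm{MMSE}^{\mathcal H}(S\vert X^\sigma),\qquad \epsilon_A := \mathbb E\big[(\eta^\sigma(X^\sigma)-h^*_{\mathcal H}(X^\sigma))^2\big].$$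
   Context: $\mathrm{MMSE}(S\vert X^\sigma)=\inf_{h}\mathbb E[(S-h(X^\sigma))^2]$, the infimum being over all Borel measurable $h:\mathbb R^d\to\mathbb R$. $\eta^\sigma(x)=\mathbb E[S\vert X^\sigma=x]$ is the conditional expectation. $\mathrm{MMSE}^{\mathcal H}(S\vert X^\sigma)=\min_{h\in\mathcal H}\mathbb E[(S-h(X^\sigma))^2]$, and $h^*_{\mathcal H}\in\mathcal H$ denotes a minimizer (the minimum is assumed attained). For $h\in\mathcal H$, $\mathrm{MSE}_{\mathrm{train}}(h)=\frac1n\sum_{i=1}^n (S_i-h(X_i^\sigma))^2$, and $\hat h_{\mathcal H}\in\arg\min_{h\in\mathcal H}\mathrm{MSE}_{\mathrm{train}}(h)$ is an empirical minimizer (assumed to exist). The inequality holds for every realization of the training set. *)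

(* Defs.v *)
From HB Require Import structures.
From mathcomp Require Import all_boot all_order all_algebra.
From mathcomp Require Import all_classical all_reals all_analysis.

Set Implicit Arguments.
Unset Strict Implicit.
Unset Printing Implicit Defensive.

Import Order.TTheory GRing.Theory Num.Theory.

Local Open Scope classical_set_scope.
Local Open Scope ring_scope.

(* R^d is [d.-tuple R]. Its measurable structure is the sigma-algebra generated
   by the coordinate projections, i.e. the d-fold product of the Borel
   sigma-algebra of R, which is the Borel sigma-algebra of R^d. *)

Definition add_noise (R : realType) (d : nat) (sigma : R)
    (x z : d.-tuple R) : d.-tuple R :=
  [tuple tnth x i + sigma * tnth z i | i < d].

Section random_variables.
Context {disp : measure_display} {T : measurableType disp} {R : realType}.
Variable P : probability T R.

Definition independent2 {d1 d2 : measure_display} {U : measurableType d1}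
    {V : measurableType d2} (X : T -> U) (Y : T -> V) : Prop :=
  forall (A : set U) (B : set V), measurable A -> measurable B ->
    P (X @^-1` A `&` Y @^-1` B) = (P (X @^-1` A) * P (Y @^-1` B))%E.

Definition mutually_independent {n : nat} {d1 : measure_display}
    {U : measurableType d1} (X : 'I_n -> T -> U) : Prop :=
  forall (J : {set 'I_n}) (A : 'I_n -> set U), (forall i, measurable (A i)) ->
    P [set w | forall i, i \in J -> A i (X i w)] =
    (\prod_(i in J) P (X i @^-1` A i))%E.

(* N(0, I) is the product measure N(0, 1) x ... x N(0, 1); a law on R^d is
   determined by its values on measurable boxes. *)
Definition standard_gaussian {d : nat} (Z : T -> d.-tuple R) : Prop :=
  forall A : 'I_d -> set R, (forall i, measurable (A i)) ->
    P [set w | forall i, A i (tnth (Z w) i)] =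
    (\prod_(i < d) normal_prob 0 1 (A i))%E.

Definition mse {U : Type} (S : T -> R) (Y : T -> U) (h : U -> R) : \bar R :=
  'E_P[fun w => ((S w - h (Y w)) ^+ 2)%R].

(* [mmse_over S Y H] may be +oo a priori: the mean squared error of an
   arbitrary measurable [h] need not be finite. *)
Definition mmse_over {U : Type} (S : T -> R) (Y : T -> U) (H : set (U -> R))
    : \bar R :=
  ereal_inf [set mse S Y h | h in H].

Definition mmse {d1 : measure_display} {U : measurableType d1}
    (S : T -> R) (Y : T -> U) : \bar R :=
  mmse_over S Y [set h | measurable_fun [set: U] h].

(* [eta] is a version of y |-> E[S | Y = y]; it is determined up to a null set
   of the law of [Y]. *)
Definition is_cond_expectation {d1 : measure_display} {U : measurableType d1}
    (S : T -> R) (Y : T -> U) (eta : U -> R) : Prop :=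
  [/\ measurable_fun [set: U] eta,
      P.-integrable [set: T] (fun w => (eta (Y w))%:E) &
      forall B : set U, measurable B ->
        (\int[P]_(w in Y @^-1` B) (eta (Y w))%:E =
         \int[P]_(w in Y @^-1` B) (S w)%:E)%E].

End random_variables.

Definition is_iid_sample {R : realType}
    {disp : measure_display} {T : measurableType disp} (P : probability T R)
    {disp' : measure_display} {T' : measurableType disp'}
    (P' : probability T' R)
    {d1 : measure_display} {U : measurableType d1}
    {n : nat} (D : 'I_n -> T' -> U) (V : T -> U) : Prop :=
  [/\ forall i, measurable_fun [set: T'] (D i),
      forall i (A : set U), measurable A ->
        P' (D i @^-1` A) = P (V @^-1` A) &
      mutually_independent P' D].

Definition mse_train {R : realType} {U : Type} {n : nat}
    (D : 'I_n -> U * R) (h : U -> R) : R :=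
  n%:R^-1 * \sum_(i < n) ((D i).2 - h (D i).1) ^+ 2.

Definition is_argmin {U : Type} {o : Order.disp_t} {V : porderType o}
    (H : set U) (F : U -> V) (h : U) : Prop :=
  H h /\ forall g, H g -> (F h <= F g)%O.

(* Main.v *)
(* Since hhat minimises the training error, it suffices to bound
   MSE_train(hstar) - epsC = E[(S - hstar)^2]. By Pythagoras around
   eta = E[S | Xs] this is E[(S - eta)^2] + epsA, and E[(S - eta)^2] is at most
   the error of every measurable h. To avoid proving eta bounded or square
   integrable, both steps are merged into one pointwise identity involving only
   the integrability of eta; h may be clipped to [0, 1] as S lies there. *)
Require Import Defs.
From HB Require Import structures.
From mathcomp Require Import all_boot all_order all_algebra.
From mathcomp Require Import all_classical all_reals all_analysis.
From mathcomp Require Import measurable_realfun ring lra.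

Set Implicit Arguments.
Unset Strict Implicit.
Unset Printing Implicit Defensive.

Import Order.TTheory GRing.Theory Num.Theory.

Local Open Scope classical_set_scope.
Local Open Scope ring_scope.

(** * Orthogonality to functions of [Y] by counting thresholds *)

(** The sum counts the thresholds 1, ..., N that [y] reaches, so it is the integer part of [y]. In
    the induction, either [y <= N] and the threshold N + 1 is not reached, or all of the first N are
    reached and [y] lies in ]N, N + 1]. *)
Lemma sum_thresholds_approx (R : realType) (N : nat) (y : R) :
  0 <= y <= N%:R -> `|y - \sum_(j < N) (j.+1%:R <= y)%R%:R| <= 1.
Proof.
elim: N => [|N IH] /andP[y0 yN].
  by rewrite big_ord0 subr0 (_ : y = 0) ?normr0 ?ler01//; apply/le_anti/andP.
rewrite big_ord_recr /=; have [yleN|yltN] := leP y N%:R.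
  rewrite [_ <= y]leNgt (le_lt_trans yleN) ?ltr_nat//= addr0.
  by apply: IH; rewrite y0.
have -> : \sum_(j < N) (j.+1%:R <= y)%R%:R = N%:R :> R.
  under eq_bigr => j _.
    rewrite (le_trans _ (ltW yltN)) ?ler_nat ?ltn_ord//; over.
  by rewrite sumr_const card_ord.
rewrite -natr1 in yN *.
by case: (_ <= y) => /=; rewrite ler_norml; lra.
Qed.

(* Multiply by N and replace [N * phi] by the number of integer thresholds it
   exceeds: the error is at most [\int `|psi|], uniformly in N. *)
Lemma Rintegral_mul_comp_eq0 (R : realType) (d1 d2 : measure_display)
    (T : measurableType d1) (U : measurableType d2)
    (mu : {measure set T -> \bar R}) (psi : T -> R) (Y : T -> U)
    (phi : U -> R) :
  mu.-integrable [set: T] (EFin \o psi) ->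
  measurable_fun [set: T] Y ->
  (forall B, measurable B ->
    (\int[mu]_(w in Y @^-1` B) (psi w)%:E = 0)%E) ->
  measurable_fun [set: U] phi ->
  (forall u, 0 <= phi u <= 1) ->
  \int[mu]_w (psi w * phi (Y w)) = 0.
Proof.
move=> ipsi mY psi0 mphi phi01.
have imul (g : T -> R) : measurable_fun [set: T] g ->
    (exists M : R, forall w, `|g w| <= M) ->
    mu.-integrable [set: T] (EFin \o (fun w => psi w * g w)).
  move=> mg [M gM].
  have bg : [bounded g w | w in [set: T]].
    exists M; split; [exact: num_real|move=> x Mx w _ /=].
    exact: le_trans (gM w) (ltW Mx).
  exact: (integrableMl measurableT ipsi mg bg).
have mphiY : measurable_fun [set: T] (phi \o Y) by exact: measurableT_comp.
have iphi : mu.-integrable [set: T] (EFin \o (fun w => psi w * phi (Y w))).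
  apply: imul => //; exists 1 => w /=.
  by have /andP[p0 p1] := phi01 (Y w); rewrite ger0_norm.
set I := Rintegral _ _ _.
(* A bound on N |I| uniform in N forces I = 0: otherwise some integer N exceeds |I|^-1 times the
   integral of |psi|. *)
suff bnd N : N%:R * `|I| <= \int[mu]_w `|psi w|.
  apply/eqP; rewrite -normr_le0 leNgt; apply/negP => I0.
  have := bnd (Num.truncn (`|I|^-1 * \int[mu]_w `|psi w|)).+1.
  rewrite leNgt => /negP; apply.
  rewrite mulrC -ltr_pdivrMl//; exact: truncnS_gt.
pose B j := [set u | j.+1%:R <= N%:R * phi u].
have mB j : measurable (B j).
  rewrite -[B j]setTI; apply: measurable_fun_le => //.
  exact: measurable_funM.
have mYB j : measurable (Y @^-1` B j) by rewrite -[_ @^-1` _]setTI; exact: mY.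
(* [s] is the number of thresholds 1, ..., N reached by N phi(Y). It approximates N phi(Y) to within
   1. *)
pose s w := \sum_(j < N) \1_(Y @^-1` B j) w : R.
have ms : measurable_fun [set: T] s.
  by apply: measurable_sum => j; exact: measurable_indic.
have iind j : mu.-integrable [set: T]
    (EFin \o (fun w => psi w * \1_(Y @^-1` B j) w)).
  apply: imul => //; exists 1 => w.
  by rewrite indicE; case: (_ \in _); rewrite ?normr1 ?normr0.
have s_bnd w : `|N%:R * phi (Y w) - s w| <= 1.
  rewrite /s; under eq_bigr => j _.
    rewrite indicE (_ : (w \in Y @^-1` B j) = (j.+1%:R <= N%:R * phi (Y w))).
      over.
    by apply/idP/idP; rewrite inE.
  apply: sum_thresholds_approx; have /andP[p0 p1] := phi01 (Y w).
  by rewrite mulr_ge0//= ler_piMr.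
(* [s] is a finite sum of indicators of preimages under [Y], on each of which [psi] integrates to
   0. *)
have is0 : \int[mu]_w (psi w * s w) = 0.
  rewrite /Rintegral; under eq_integral => w _.
    rewrite /s mulr_sumr -sumEFin; over.
  rewrite integral_sum//; last by move=> j; exact: iind.
  rewrite big1// => j _.
  rewrite -[RHS](psi0 _ (mB j)) [RHS]integral_mkcond.
  apply: eq_integral => w _.
  by rewrite patchE indicE; case: ifPn => _; rewrite ?mulr1 ?mulr0.
rewrite -[N%:R]normr_nat -normrM -RintegralZl//.
have iN : mu.-integrable [set: T] (EFin \o (fun w => N%:R * (psi w * phi (Y w)))).
  exact: (integrableZl measurableT N%:R iphi).
have is' : mu.-integrable [set: T] (EFin \o (fun w => psi w * s w)).
  apply: imul => //; exists N%:R => w.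
  rewrite /s (le_trans (ler_norm_sum _ _ _))//.
  rewrite -[leRHS]mulr1 mulr_natl -[in leRHS](card_ord N) -sumr_const ler_sum//.
  by move=> j _; rewrite indicE; case: (_ \in _); rewrite ?normr1 ?normr0.
(* Subtracting the zero integral of psi s turns the integrand into psi (N phi(Y) - s), which is at
   most |psi| in absolute value. *)
rewrite -[X in `|X|]subr0 -is0 -RintegralB//.
have id : mu.-integrable [set: T] (EFin \o
    (fun w => N%:R * (psi w * phi (Y w)) - psi w * s w)).
  exact: (integrableB measurableT iN is').
apply: le_trans (le_normr_Rintegral measurableT id) _.
apply: le_Rintegral => //; first exact: (integrable_norm id).
  exact: (integrable_norm ipsi).
move=> w _; rewrite mulrCA -mulrBr normrM ler_piMr//; exact: s_bnd.
Qed.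

(** * Comparison of mean squared errors through the conditional expectation *)

Lemma integrable_le1 (R : realType) (d : measure_display)
    (T : measurableType d) (P : probability T R) (f : T -> R) :
  measurable_fun [set: T] f -> (forall w, `|f w| <= 1) ->
  P.-integrable [set: T] (EFin \o f).
Proof.
move=> mf f1; apply: measurable_bounded_integrable => //.
  exact: le_lt_trans (probability_le1 P measurableT) (ltry _).
exists 1; split; [exact: num_real|move=> x x1 w _ /=].
exact: le_trans (f1 w) (ltW x1).
Qed.

(** Two values in [0, 1] differ by at most 1. This makes the errors finite, so that they can be
    handled as real numbers. *)
Lemma integrable_sq_error (R : realType) (d1 d2 : measure_display)
    (T : measurableType d1) (U : measurableType d2) (P : probability T R)
    (S : T -> R) (Y : T -> U) (f : U -> R) :
  measurable_fun [set: T] S -> (forall w, 0 <= S w <= 1) ->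
  measurable_fun [set: T] Y ->
  measurable_fun [set: U] f -> (forall u, 0 <= f u <= 1) ->
  P.-integrable [set: T] (EFin \o (fun w => (S w - f (Y w)) ^+ 2)).
Proof.
move=> mS S01 mY mf f01; apply: integrable_le1.
  apply: measurable_funX; apply: measurable_funB => //.
  exact: (measurableT_comp mf mY).
move=> w; rewrite normrX expr_le1// ler_norml.
by have /andP[? ?] := f01 (Y w); have /andP[? ?] := S01 w; lra.
Qed.

(* With [e := eta \o Y], expanding the squares gives
   (S - h)^2 + (e - k)^2 - (S - k)^2 = (h - e)^2 + 2 (e - S) (h - k),
   and [e - S] is orthogonal to bounded functions of [Y]. *)
Lemma mse_le_add_cond_expectation01 (R : realType) (d1 d2 : measure_display)
    (T : measurableType d1) (U : measurableType d2) (P : probability T R)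
    (S : T -> R) (Y : T -> U) (eta h k : U -> R) :
  measurable_fun [set: T] S -> (forall w, 0 <= S w <= 1) ->
  measurable_fun [set: T] Y ->
  is_cond_expectation P S Y eta ->
  measurable_fun [set: U] h -> (forall u, 0 <= h u <= 1) ->
  measurable_fun [set: U] k -> (forall u, 0 <= k u <= 1) ->
  (mse P S Y k <=
    mse P S Y h + 'E_P[fun w => ((eta (Y w) - k (Y w)) ^+ 2)%R])%E.
Proof.
move=> mS S01 mY [meta ieta etaE] mh h01 mk k01.
have mcomp (f : U -> R) : measurable_fun [set: U] f ->
    measurable_fun [set: T] (fun w => f (Y w)).
  by move=> mf; exact: (measurableT_comp mf mY).
have iS : P.-integrable [set: T] (EFin \o S).
  apply: integrable_le1 => // w.
  by have /andP[? ?] := S01 w; rewrite ger0_norm.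
pose psi w := eta (Y w) - S w.
have ipsi : P.-integrable [set: T] (EFin \o psi).
  exact: (integrableB measurableT ieta iS).
have psi_orth (f : U -> R) : measurable_fun [set: U] f ->
    (forall u, 0 <= f u <= 1) -> \int[P]_w (psi w * f (Y w)) = 0.
  (* The defining property of [eta] says exactly that [psi] integrates to 0 over each preimage of a
     measurable set under [Y]. *)
  apply: Rintegral_mul_comp_eq0 => // B mB.
  have mYB : measurable (Y @^-1` B) by rewrite -[_ @^-1` _]setTI; exact: mY.
  under eq_integral do rewrite EFinB.
  have sub (g : T -> R) : P.-integrable [set: T] (EFin \o g) ->
      P.-integrable (Y @^-1` B) (EFin \o g) by exact: integrableS.
  rewrite (integralB_EFin mYB (sub _ ieta) (sub _ iS)) (etaE _ mB).
  by rewrite subee// (integrable_fin_num mYB (sub _ iS)).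
have ipsif (f : U -> R) : measurable_fun [set: U] f ->
    (forall u, 0 <= f u <= 1) ->
    P.-integrable [set: T] (EFin \o (fun w => psi w * f (Y w))).
  move=> mf f01.
  have bf : [bounded f (Y w) | w in [set: T]].
    exists 1; split; [exact: num_real|move=> x x1 w _ /=].
    by have /andP[? ?] := f01 (Y w); rewrite ger0_norm// (le_trans _ (ltW x1)).
  exact: (integrableMl measurableT ipsi (mcomp _ mf) bf).
rewrite /mse unlock.
(* If E[(eta - k)^2] is infinite the bound is trivial; otherwise all three terms are finite. *)
have [->|epsA_fin] := eqVneq (\int[P]_w ((eta (Y w) - k (Y w)) ^+ 2)%:E)%E +oo%E.
  rewrite addey ?leey// gt_eqF// (lt_le_trans ltNy0)//.
  by apply: integral_ge0 => w _; rewrite lee_fin sqr_ge0.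
have iepsA : P.-integrable [set: T]
    (EFin \o (fun w => (eta (Y w) - k (Y w)) ^+ 2)).
  apply/integrableP; split.
    apply/measurable_EFinP; apply: measurable_funX.
    by apply: measurable_funB; exact: mcomp.
  under eq_integral => w _ do rewrite /= ger0_norm ?sqr_ge0//.
  by rewrite ltey.
have ih := integrable_sq_error P mS S01 mY mh h01.
have ik := integrable_sq_error P mS S01 mY mk k01.
rewrite -[leLHS]fineK ?integrable_fin_num//.
rewrite -[X in (_ <= X + _)%E]fineK ?(integrable_fin_num measurableT ih)//.
rewrite -[X in (_ <= _ + X)%E]fineK ?(integrable_fin_num measurableT iepsA)//.
rewrite -EFinD lee_fin -!/(Rintegral _ _ _).
rewrite -(RintegralD measurableT ih iepsA).
have ihk := integrableB measurableT (ipsif _ mh h01) (ipsif _ mk k01).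
have i2hk := integrableZl measurableT 2 ihk.
(* Zero is added on the left as 2 (E[psi h] - E[psi k]), so that the integrands can be compared
   pointwise. *)
rewrite -[leLHS]addr0 -(mulr0 2) -[X in 2 * X](subrr 0).
rewrite -{1}(psi_orth _ mh h01) -(psi_orth _ mk k01).
rewrite -(RintegralB measurableT (ipsif _ mh h01) (ipsif _ mk k01)).
rewrite -(RintegralZl _ measurableT ihk) -(RintegralD measurableT ik i2hk).
apply: le_Rintegral => //.
- exact: (integrableD measurableT ik i2hk).
- exact: (integrableD measurableT ih iepsA).
move=> w _; rewrite -subr_ge0 /psi.
set e := eta _; set hw := h _; set kw := k _.
have -> : (S w - hw) ^+ 2 + (e - kw) ^+ 2 - ((S w - kw) ^+ 2 +
    2 * ((e - S w) * hw - (e - S w) * kw)) = (hw - e) ^+ 2 by ring.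
exact: sqr_ge0.
Qed.

(** Projecting the values of [h] onto [0, 1] never moves them away from [S], which lies there, so
    the clipped function has no larger error. *)
Lemma mse_le_add_cond_expectation (R : realType) (d1 d2 : measure_display)
    (T : measurableType d1) (U : measurableType d2) (P : probability T R)
    (S : T -> R) (Y : T -> U) (eta h k : U -> R) :
  measurable_fun [set: T] S -> (forall w, 0 <= S w <= 1) ->
  measurable_fun [set: T] Y ->
  is_cond_expectation P S Y eta ->
  measurable_fun [set: U] h ->
  measurable_fun [set: U] k -> (forall u, 0 <= k u <= 1) ->
  (mse P S Y k <=
    mse P S Y h + 'E_P[fun w => ((eta (Y w) - k (Y w)) ^+ 2)%R])%E.
Proof.
move=> mS S01 mY etaP mh mk k01.
pose g u := Num.max 0 (Num.min 1 (h u)).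
have mg : measurable_fun [set: U] g.
  by apply: measurable_maxr => //; exact: measurable_minr.
have g01 u : 0 <= g u <= 1.
  by rewrite le_max lexx/= ge_max ler01/= ge_min lexx.
apply: (le_trans (mse_le_add_cond_expectation01 mS S01 mY etaP mg g01 mk k01)).
have msq (f : U -> R) : measurable_fun [set: U] f ->
    measurable_fun [set: T] (fun w => ((S w - f (Y w)) ^+ 2)%:E).
  move=> mf; apply/measurable_EFinP; apply: measurable_funX.
  by apply: measurable_funB => //; exact: (measurableT_comp mf mY).
apply: leeD => //; rewrite /mse unlock.
apply: ge0_le_integral => //; try exact: msq.
  by move=> w _; rewrite lee_fin sqr_ge0.
move=> w _; rewrite lee_fin /g; have /andP[S0 S1] := S01 w.
have [h1|h1] := leP 1 (h (Y w)); first by rewrite max_r//; nra.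
by have [h0|h0] := leP 0 (h (Y w)); nra.
Qed.

(** * The training bound *)

Theorem theorem1 (R : realType) (d n : nat) (hd : (0 < d)%N) (hn : (0 < n)%N)
  (disp : measure_display) (T : measurableType disp) (P : probability T R)
  (X : {RV P >-> d.-tuple R}) (S : {RV P >-> R}) (Z : {RV P >-> d.-tuple R})
  (sigma : R)
  (S01 : forall w, 0 <= S w <= 1)
  (sigma_gt0 : 0 < sigma)
  (Z_gauss : standard_gaussian P Z)
  (Z_indep : independent2 P Z (fun w => (X w, S w)))
  (Xs : T -> d.-tuple R)
  (XsE : Xs = fun w => add_noise sigma (X w) (Z w))
  (disp' : measure_display) (T' : measurableType disp') (P' : probability T' R)
  (D : 'I_n -> T' -> (d.-tuple R * R)%type)
  (D_iid : is_iid_sample P P' D (fun w => (Xs w, S w)))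
  (H : set (d.-tuple R -> R))
  (H_meas : forall h, H h -> measurable_fun [set: d.-tuple R] h)
  (H_01 : forall h, H h -> forall x, 0 <= h x <= 1)
  (eta : d.-tuple R -> R)
  (eta_cond : is_cond_expectation P S Xs eta)
  (hstar : d.-tuple R -> R)
  (hstar_min : is_argmin H (mse P S Xs) hstar) :
  forall (w' : T') (hhat : d.-tuple R -> R),
    is_argmin H (mse_train (fun i => D i w')) hhat ->
    let epsC := ((mse_train (fun i => D i w') hstar)%:E - mmse_over P S Xs H)%E in
    let epsA := 'E_P[fun w => ((eta (Xs w) - hstar (Xs w)) ^+ 2)%R]%E in
    ((mse_train (fun i => D i w') hhat)%:E - epsC - epsA <= mmse P S Xs)%E.
Proof.
move=> w' hhat [_ hhat_min]; cbv zeta.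
set epsC := (_ - mmse_over _ _ _ _)%E; set epsA := ('E_P[_])%E.
have [Hstar hstar_le] := hstar_min.
have mXs : measurable_fun [set: T] Xs.
  rewrite XsE; apply/measurable_fun_tnthP => i.
  rewrite [X in measurable_fun _ X](_ : _ =
      (fun w => tnth (X w) i + sigma * tnth (Z w) i)); last first.
    by apply/funext => w /=; rewrite tnth_mktuple.
  apply: measurable_funD.
    exact: (measurableT_comp (measurable_tnth i) (measurable_funPT X)).
  apply: measurable_funM => //.
  exact: (measurableT_comp (measurable_tnth i) (measurable_funPT Z)).
have mstar := H_meas _ Hstar; have star01 := H_01 _ Hstar.
have mmse_overE : mmse_over P S Xs H = mse P S Xs hstar.
  apply/eqP; rewrite eq_le ereal_inf_lbound ?andTb; last by exists hstar.
  by apply: le_ereal_inf_tmp => _ [g Hg <-]; exact: hstar_le.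
have mse_fin : mse P S Xs hstar \is a fin_num.
  rewrite /mse unlock integrable_fin_num//.
  exact: (integrable_sq_error P (measurable_funPT S) S01 mXs mstar star01).
apply: le_ereal_inf_tmp => _ [h mh <-].
(* The left side is the error of [hstar] plus the training error of [hhat] minus that of [hstar], a
   difference that is at most 0. *)
have epsC_le : ((mse_train (fun i => D i w') hhat)%:E - epsC
    <= mse P S Xs hstar)%E.
  rewrite /epsC mmse_overE -(fineK mse_fin) -!EFinB lee_fin opprB addrCA.
  by rewrite gerDl subr_le0; exact: hhat_min.
have := mse_le_add_cond_expectation (measurable_funPT S) S01 mXs eta_cond mh
  mstar star01.
rewrite -/epsA; have : (0 <= epsA)%E.
  by apply: expectation_ge0 => w; exact: sqr_ge0.
(* For infinite [epsA] the left side is -oo; for finite [epsA] it moves to the other side. *)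
case: epsA => [r _|_ _|//]; last by rewrite addeNy leNye.
by rewrite leeBlDr//; exact: le_trans.
Qed.
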